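(* Suppose that $f\in\mathcal P$ and $f(z)=\sum_{n=0}^{\infty}a_nz^n$ with $a_0\in[0,1)$. Also, let $q\ge1$, $m\in\mathbb N$, $\{\zeta_n(r)\}_{n=0}^{\infty}\in\mathcal F$, $\Phi_1(r)=\sum_{n=1}^{\infty}\zeta_n(r)$ and $$E_f(\zeta,p,r):=a_0^p\,\zeta_0(r)+\sum_{n=1}^{\infty}|a_n|\zeta_n(r)+|f(z^m)-a_0|^q,\qquad |z|=r.$$ Then we have the following: (i) If $p\in(0,1]$ and $$\zeta_0(r)\ge\frac2p\Big[\Phi_1(r)+2^{q-1}\frac{r^{mq}}{(1-r^m)^q}\Big]$$ for $r\in[0,R_{m,q}^p]$, where $R_{m,q}^p$ is the minimal positive root of the equation $$\zeta_0(r)=\frac2p\Big[\Phi_1(r)+2^{q-1}\frac{r^{mq}}{(1-r^m)^q}\Big],$$ then $$E_f(\zeta,p,r)\le\zeta_0(r)\quad\text{for all } r\le R_{m,q}^p.$$ When $p=1$, the result is sharp for all $q\ge1$ and $m\in\mathbb N$. Moreover, when $q=1$, this result is sharp for all $p\in(0,1]$ and $m\in\mathbb N$. (ii) If $p=2$ and $$\zeta_0(r)\ge\frac{2\Phi_1(r)+2^q(1-a_0)^{q-1}\frac{r^{mq}}{(1-r^m)^q}}{1+a_0}=:\psi(r),$$ then $$E_f(\zeta,2,r)\le\zeta_0(r)\quad\text{for all } r\le R_{m,q}^2,$$ where $R_{m,q}^2$ is the minimal positive root of the equation $\zeta_0(r)=\psi(r)$, and the result is sharp.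
   Context: $\mathbb D=\{z\in\mathbb C:|z|<1\}$. $\mathcal P$ is the class of analytic functions $f$ on $\mathbb D$ with $\operatorname{Re} f(z)<1$ for all $z\in\mathbb D$. $\mathcal F$ is the set of all sequences $\zeta=\{\zeta_n(r)\}_{n=0}^\infty$ of nonnegative continuous functions on $[0,1)$ such that $\sum_{n=0}^\infty\zeta_n(r)$ converges locally uniformly with respect to $r\in[0,1)$.
   Formalization: Sharpness (no larger radius works) is asserted only if ζ_0(r) is below the right-hand side at points arbitrarily close to R from the right; otherwise it is false, as for m=q=p=1, ζ_n=0 (n≥1), ζ_0=2r/(1-r)+(r-1/2)^2. Failure is also shown at each r>R where ζ_0 is below it. *)

(* Defs.v *)
From Stdlib Require Import Reals.
From Coquelicot Require Import Coquelicot.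
Open Scope R_scope.

(** Stdlib's [Rpower x y] is [exp (y * ln x)] with [ln 0 = 0], so that
    [Rpower 0 y = 1]; here [0 ^ y = 0].  Only used for [x >= 0], and with
    [x > 0] whenever the exponent may vanish. *)
Definition rpow (x y : R) : R := if Rlt_dec 0 x then Rpower x y else 0.

(** [f] is a total function, of which only the values on the open unit disc
    matter; differentiability is over the complex field. *)
Definition classP (f : C -> C) : Prop :=
  forall z : C, Cmod z < 1 ->
    ex_derive (K := C_AbsRing) (V := C_NormedModule) f z /\ Re (f z) < 1.

Definition Taylor_disc (f : C -> C) (a : nat -> C) : Prop :=
  forall z : C, Cmod z < 1 ->
    is_pseries (K := C_AbsRing) (V := C_NormedModule) a z (f z).

Definition classP_coef (a0 : R) (f : C -> C) (a : nat -> C) : Prop :=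
  classP f /\ Taylor_disc f a /\ a 0%nat = RtoC a0.

Definition classF (zeta : nat -> R -> R) : Prop :=
  (forall n, continuous_on (fun r => 0 <= r < 1) (zeta n)) /\
  (forall n r, 0 <= r < 1 -> 0 <= zeta n r) /\
  (forall r0, 0 <= r0 < 1 -> exists delta : posreal,
     CVU_dom (fun N r => sum_n (fun n => zeta n r) N)
       (fun r => 0 <= r < 1 /\ Rabs (r - r0) < delta)).

Definition Phi1 (zeta : nat -> R -> R) (r : R) : R :=
  Series (fun n => zeta (S n) r).

(** The quantity E_f(zeta, p, r) at a point [z] with [|z| = r].  It is only
    used when [a 0] is real. *)
Definition Ef (q : R) (m : nat) (zeta : nat -> R -> R) (p : R)
    (f : C -> C) (a : nat -> C) (z : C) : R :=
  rpow (Re (a 0%nat)) p * zeta 0%nat (Cmod z)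
  + Series (fun n => Cmod (a (S n)) * zeta (S n) (Cmod z))
  + rpow (Cmod (f (z ^ m)%C - a 0%nat)%C) q.

(** r^(mq) / (1 - r^m)^q *)
Definition Kmq (q : R) (m : nat) (r : R) : R :=
  rpow r (INR m * q) / rpow (1 - r ^ m) q.

Definition min_pos_root (g h : R -> R) (rho : R) : Prop :=
  0 < rho < 1 /\ g rho = h rho /\ forall r, 0 < r < rho -> g r <> h r.

Definition holds_upto (Fam : (C -> C) -> (nat -> C) -> Prop)
    (E : (C -> C) -> (nat -> C) -> C -> R) (g : R -> R) (s : R) : Prop :=
  forall f a z, Fam f a -> Cmod z <= s -> E f a z <= g (Cmod z).

(** The radius [rho], a root of [g = h], is best possible for
    "[E <= g] on [|z| <= rho] for all members of [Fam]": the inequality fails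
    for some member of [Fam] at every radius beyond [rho] where [g < h], and no
    radius larger than [rho] is admissible if [g < h] arbitrarily close to
    [rho] on its right.  Without the last proviso the claim is false: a
    root at which [g - h] touches zero without becoming negative, such as
    [g r = h r + (r - 1/2)^2], is not an obstruction to the inequality. *)
Definition sharp_radius (Fam : (C -> C) -> (nat -> C) -> Prop)
    (E : (C -> C) -> (nat -> C) -> C -> R) (g h : R -> R) (rho : R) : Prop :=
  (forall r, rho < r < 1 -> g r < h r ->
     exists f a z, Fam f a /\ Cmod z = r /\ g r < E f a z) /\
  ((forall eps, 0 < eps ->
      exists r, rho < r < rho + eps /\ r < 1 /\ g r < h r) ->
   forall s, rho < s < 1 -> ~ holds_upto Fam E g s).

(* Main.v *)
Require Import Defs.
From Stdlib Require Import Reals Lra Lia.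
From Coquelicot Require Import Coquelicot.
Open Scope R_scope.

(** The upper bound rests on the Carathéodory estimate [|a_n| <= 2 (1 - a_0)] for
    [Re f < 1], which also gives [|f(w) - a_0| <= 2 (1 - a_0) |w| / (1 - |w|)].
    It is obtained without integration: a Taylor polynomial [P] of [f] satisfies
    [Re P <= 1 + eps] on [|z| = r], and averaging the nonnegative quantity
    [(1 + eps - Re P(r w)) (1 + Re (u w^-n))], [|u| = 1], over the roots of unity [w]
    of an order exceeding twice the degree is exact and isolates [a_0] and [a_n].

    All these bounds are equalities for
    [f(z) = a_0 - 2 (1 - a_0) z / (1 - z)] at [z = r >= 0].  This gives sharpness in
    (ii), and in (i) with [a_0 = 0] when [p = 1] and with [a_0] tending to 1 when
    [q = 1], where [(1 - a_0^p) / (1 - a_0)] tends to [p]. *)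

(* [ring] and [field] do not see through the carrier [AbelianMonoid.sort _] in
   which rewriting with [sum_n] lemmas leaves equations. *)
Ltac as_C := match goal with |- @eq _ ?a ?b => change (@eq C a b) end.

(** * Convergent complex series and geometric tails *)

Lemma pow_n_C (z : C) (n : nat) : pow_n (K := C_AbsRing) z n = (z ^ n)%C.
Proof. induction n as [|n IH]; [reflexivity|]. rewrite Cpow_S, <- IH. reflexivity. Qed.

(** The topology of [C] comes from its product uniform structure; [locally_norm] gives the same
    neighbourhoods in terms of [Cmod]. *)
Lemma is_series_C_eps (s : nat -> C) (l : C) :
  is_series (K := C_AbsRing) (V := C_NormedModule) s l <->
  (forall eps : posreal, eventually (fun n => Cmod (sum_n s n - l)%C < eps)).
Proof.
  split; intros H.
  - intros eps.
    apply (H (fun x => Cmod (x - l)%C < eps)).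
    apply (locally_le_locally_norm (K := C_AbsRing) (V := C_NormedModule)).
    exists eps; intros y Hy; exact Hy.
  - intros P HP.
    apply (locally_norm_le_locally (K := C_AbsRing) (V := C_NormedModule)) in HP.
    destruct HP as [eps He]. destruct (H eps) as [N HN].
    exists N; intros n Hn. apply He, HN, Hn.
Qed.

Lemma is_series_C_terms_bounded (s : nat -> C) (l : C) :
  is_series (K := C_AbsRing) (V := C_NormedModule) s l ->
  exists M, forall n, Cmod (s n) <= M.
Proof.
  intros H.
  destruct (filterlim_bounded (K := C_AbsRing) (V := C_NormedModule) (sum_n s))
    as [M HM]; [now exists l|].
  change (forall n, Cmod (sum_n s n) <= M) in HM.
  exists (2 * M). intros [|n].
  - specialize (HM 0%nat). rewrite sum_O in HM. pose proof (Cmod_ge_0 (s 0%nat)). lra.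
  - pose proof (HM n) as H1. pose proof (HM (S n)) as H2.
    rewrite sum_Sn in H2. change (Cmod (sum_n s n + s (S n))%C <= M) in H2.
    replace (s (S n)) with ((sum_n s n + s (S n)) + - sum_n s n)%C by ring.
    eapply Rle_trans; [apply Cmod_triangle|]. rewrite Cmod_opp. lra.
Qed.

(** Partial sums beyond [N] differ from [sum_n s N] by at most a finite geometric sum, and this
    bound passes to the limit. It serves for Taylor polynomials of large degree and, with [N = 0],
    for the distance from [f z] to [a 0]. *)
Lemma is_series_C_geom_tail (s : nat -> C) (l : C) (N : nat) (M t : R) :
  0 <= M -> 0 <= t < 1 ->
  (forall k, (N < k)%nat -> Cmod (s k) <= M * t ^ k) ->
  is_series (K := C_AbsRing) (V := C_NormedModule) s l ->
  Cmod (l - sum_n s N)%C <= M * t ^ S N / (1 - t).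
Proof.
  intros HM Ht Hs Hl.
  (* The factor [1 - t ^ d] records the exact finite geometric sum; without it the induction would
     not close. *)
  assert (Hp : forall d, Cmod (sum_n s (d + N) - sum_n s N)%C
                         <= M * t ^ S N / (1 - t) * (1 - t ^ d)).
  { induction d as [|d IH].
    - simpl. replace (sum_n s N - sum_n s N)%C with (RtoC 0) by ring.
      rewrite Cmod_0. lra.
    - replace (S d + N)%nat with (S (d + N)) by lia. rewrite sum_Sn.
      change (plus (sum_n s (d + N)) (s (S (d + N))))
        with (sum_n s (d + N) + s (S (d + N)))%C.
      replace (sum_n s (d + N) + s (S (d + N)) - sum_n s N)%C
        with ((sum_n s (d + N) - sum_n s N) + s (S (d + N)))%C by ring.
      eapply Rle_trans; [apply Cmod_triangle|].
      assert (H1 := Hs (S (d + N))%nat ltac:(lia)).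
      replace (S (d + N)) with (S N + d)%nat in * by lia.
      rewrite pow_add in H1. simpl in *.
      assert (E : M * (t * t ^ N) / (1 - t) * (1 - t * t ^ d) =
        M * (t * t ^ N) / (1 - t) * (1 - t ^ d) + M * (t * t ^ N * t ^ d))
        by (field; lra).
      rewrite E. apply Rplus_le_compat; assumption. }
  apply le_epsilon. intros eps He.
  apply is_series_C_eps with (eps := mkposreal eps He) in Hl.
  destruct Hl as [K HK]. specialize (HK (K + N)%nat ltac:(lia)). simpl in HK.
  specialize (Hp K).
  replace (l - sum_n s N)%C
    with ((sum_n s (K + N) - sum_n s N) + - (sum_n s (K + N) - l))%C by ring.
  eapply Rle_trans; [apply Cmod_triangle|]. rewrite Cmod_opp.
  apply Rplus_le_compat; [|lra].
  eapply Rle_trans; [apply Hp|].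
  assert (0 <= t ^ K) by (apply pow_le; lra).
  assert (0 <= M * t ^ S N / (1 - t)).
  { apply Rmult_le_pos; [|left; apply Rinv_0_lt_compat; lra].
    apply Rmult_le_pos; [assumption|apply pow_le; lra]. }
  nra.
Qed.

(** * Sums over roots of unity *)

Definition cis (t : R) : C := (cos t, sin t).

Lemma cis_pow (t : R) (n : nat) : (cis t ^ n)%C = cis (INR n * t).
Proof.
  induction n as [|n IH].
  - unfold cis. simpl. rewrite Rmult_0_l, cos_0, sin_0. reflexivity.
  - rewrite Cpow_S, IH, S_INR. unfold cis, Cmult; simpl.
    replace ((INR n + 1) * t) with (t + INR n * t) by ring.
    rewrite cos_plus, sin_plus. f_equal; ring.
Qed.

Lemma Cmod_cis (t : R) : Cmod (cis t) = 1.
Proof.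
  unfold Cmod, cis; simpl fst; simpl snd. rewrite <- sqrt_1. f_equal.
  pose proof (sin2_cos2 t) as H. unfold Rsqr in H. simpl. lra.
Qed.

Lemma cis_neq_1 (t : R) : 0 < t < 2 * PI -> cis t <> 1.
Proof.
  intros Ht E. apply (f_equal Re) in E. simpl in E.
  replace t with (2 * (t / 2)) in E by field.
  rewrite cos_2a_sin in E.
  assert (0 < sin (t / 2)) by (apply sin_gt_0; lra).
  nra.
Qed.

Definition root_unity (N : nat) : C := cis (2 * PI / INR N).

Lemma root_unity_pow_N (N : nat) : (0 < N)%nat -> (root_unity N ^ N)%C = 1.
Proof.
  intros HN. unfold root_unity. rewrite cis_pow.
  replace (INR N * (2 * PI / INR N)) with (2 * PI) by (field; apply not_0_INR; lia).
  unfold cis. rewrite cos_2PI, sin_2PI. reflexivity.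
Qed.

Lemma root_unity_pow_neq_1 (N l : nat) :
  (0 < l < N)%nat -> (root_unity N ^ l)%C <> 1.
Proof.
  intros Hl. unfold root_unity. rewrite cis_pow.
  assert (0 < INR l) by (apply lt_0_INR; lia).
  assert (INR l < INR N) by (apply lt_INR; lia).
  apply cis_neq_1. pose proof PI_RGT_0.
  replace (INR l * (2 * PI / INR N)) with (2 * PI * (INR l / INR N)) by (field; lra).
  assert (0 < INR l / INR N) by (apply Rdiv_lt_0_compat; lra).
  assert (INR l / INR N < 1) by (apply Rlt_div_l; lra).
  nra.
Qed.

(** The sum telescopes when multiplied by [w - 1]. *)
Lemma sum_pow_root_of_unity (w : C) (n : nat) :
  (w ^ S n)%C = 1 -> w <> 1 -> sum_n (fun k => w ^ k)%C n = 0 :> C.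
Proof.
  intros Hw H1.
  assert (E : forall m, ((w - 1) * sum_n (fun k => w ^ k)%C m = w ^ S m - 1)%C).
  { induction m as [|m IH].
    - rewrite sum_O. simpl. ring.
    - rewrite sum_Sn. change (plus ?x ?y) with (x + y)%C.
      rewrite Cmult_plus_distr_l, IH. rewrite (Cpow_S w (S m)). ring. }
  specialize (E n). rewrite Hw in E.
  assert (w - 1 <> 0)%C by (now apply Cminus_eq_contra).
  replace (sum_n (fun k => w ^ k)%C n)
    with (/ (w - 1) * ((w - 1) * sum_n (fun k => w ^ k)%C n))%C.
  - rewrite E. ring.
  - rewrite Cmult_assoc, Cinv_l by assumption. ring.
Qed.

Lemma sum_n_C_const (c : C) (n : nat) : sum_n (fun _ => c) n = (INR (S n) * c)%C :> C.
Proof.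
  induction n as [|n IH].
  - rewrite sum_O. simpl. ring.
  - rewrite sum_Sn, IH, (S_INR (S n)), RtoC_plus. change (plus ?x ?y) with (x + y)%C. ring.
Qed.

Lemma sum_n_single (t : nat -> C) (i n : nat) :
  (i <= n)%nat -> (forall j, (j <= n)%nat -> j <> i -> t j = 0) -> sum_n t n = t i :> C.
Proof.
  induction n as [|n IH]; intros Hi Ht.
  - rewrite sum_O. f_equal. lia.
  - rewrite sum_Sn. change (plus ?x ?y) with (x + y)%C.
    destruct (Nat.eq_dec i (S n)) as [->|Hne].
    + rewrite (sum_n_ext_loc _ (fun _ => RtoC 0)) by (intros j Hj; apply Ht; lia).
      rewrite sum_n_C_const. ring.
    + rewrite IH, (Ht (S n)) by (try (intros; apply Ht); lia). ring.
Qed.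

Lemma sum_n_zero (t : nat -> C) (n : nat) :
  (forall j, (j <= n)%nat -> t j = 0) -> sum_n t n = 0 :> C.
Proof.
  intros Ht. rewrite (sum_n_ext_loc _ (fun _ => RtoC 0)) by assumption.
  rewrite sum_n_C_const. ring.
Qed.

(** Orthogonality of the characters of the cyclic group of order [S n]: only [l mod S n] matters,
    and a nonzero residue gives a geometric sum whose ratio is a root of unity other than 1. *)
Lemma root_unity_char_sum (n l : nat) :
  sum_n (fun k => (root_unity (S n) ^ k) ^ l)%C n
  = (if Nat.eqb (l mod S n) 0 then RtoC (INR (S n)) else 0) :> C.
Proof.
  set (w := root_unity (S n)).
  assert (Hw : (w ^ S n)%C = 1) by (apply root_unity_pow_N; lia).
  assert (Hl : (w ^ l)%C = (w ^ (l mod S n))%C).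
  { rewrite (Nat.div_mod_eq l (S n)) at 1.
    rewrite Cpow_add_r, Cpow_mult_r, Hw, Cpow_1_l. ring. }
  assert (Hsw : forall k, ((w ^ k) ^ l)%C = ((w ^ l) ^ k)%C).
  { intros k. rewrite <- !Cpow_mult_r. f_equal. lia. }
  rewrite (sum_n_ext _ _ _ Hsw).
  pose proof (Nat.mod_upper_bound l (S n) ltac:(lia)) as Hlt.
  destruct (Nat.eqb_spec (l mod S n) 0) as [E|E].
  - rewrite Hl, E. simpl Cpow at 1.
    rewrite (sum_n_ext _ (fun _ => RtoC 1)) by (intros k; apply Cpow_1_l).
    rewrite sum_n_C_const. ring.
  - apply sum_pow_root_of_unity.
    + rewrite <- Cpow_mult_r, Nat.mul_comm, Cpow_mult_r, Hw. apply Cpow_1_l.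
    + rewrite Hl. apply root_unity_pow_neq_1. lia.
Qed.

(** Once the sums are exchanged, orthogonality keeps exactly the coefficients with [j + s] divisible
    by [S n]. This discrete average replaces the Cauchy integral. *)
Lemma root_unity_poly_sum (c : nat -> C) (r : R) (n J s : nat) :
  sum_n (fun k => sum_n (fun j => c j * (r * root_unity (S n) ^ k) ^ j) J
                  * (root_unity (S n) ^ k) ^ s)%C n
  = sum_n (fun j => c j * r ^ j * (if Nat.eqb ((j + s) mod S n) 0
                                   then RtoC (INR (S n)) else 0))%C J :> C.
Proof.
  set (w := root_unity (S n)).
  transitivity (sum_n (fun k => sum_n (fun j => c j * r ^ j * (w ^ k) ^ (j + s))%C J) n : C).
  - apply sum_n_ext. intros k.
    etransitivity; [symmetry; exact (sum_n_mult_r (K := C_Ring) _ _ _)|].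
    apply sum_n_ext. intros j. change (@mult C_Ring) with Cmult. as_C.
    rewrite Cpow_mult_l, Cpow_add_r. ring.
  - rewrite sum_n_switch. apply sum_n_ext. intros j.
    rewrite <- root_unity_char_sum. fold w.
    exact (sum_n_mult_l (K := C_Ring) _ _ _).
Qed.

(** * The Carathéodory estimate for polynomials *)

Lemma Re_sum_n (t : nat -> C) (n : nat) :
  Re (sum_n t n) = sum_n (fun k => Re (t k)) n.
Proof.
  induction n as [|n IH]; [now rewrite !sum_O|].
  rewrite !sum_Sn, <- IH. reflexivity.
Qed.

Lemma sum_n_nonneg (t : nat -> R) (n : nat) :
  (forall k, 0 <= t k) -> 0 <= sum_n t n.
Proof.
  intros Ht. induction n as [|n IH]; [rewrite sum_O; apply Ht|].
  rewrite sum_Sn. apply Rplus_le_le_0_compat; [exact IH|apply Ht].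
Qed.

(** A rotation of a coefficient onto its modulus turns a bound on a real part into a bound on
    [Cmod]. *)
Lemma unit_multiplier (z : C) : exists u : C, Cmod u = 1 /\ (z * u)%C = Cmod z.
Proof.
  destruct (Req_dec (Cmod z) 0) as [E|E].
  - exists 1. split; [apply Cmod_1|]. rewrite E, (Cmod_eq_0 z E). ring.
  - exists (Cconj z / Cmod z)%C.
    assert (E' : RtoC (Cmod z) <> 0) by (intros H; apply E; now injection H).
    split.
    + rewrite Cmod_div, Cmod_conj, Cmod_R, Rabs_pos_eq by (try apply Cmod_ge_0; assumption).
      now field.
    + unfold Cdiv. rewrite Cmult_assoc, <- Cmod2_conj, RtoC_pow. simpl. now field.
Qed.

Lemma sum_n_C_plus (s t : nat -> C) (n : nat) :
  sum_n (fun k => s k + t k)%C n = (sum_n s n + sum_n t n)%C :> C.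
Proof. exact (sum_n_plus (G := C_AbelianMonoid) s t n). Qed.

Lemma sum_n_C_mult_l (c : C) (s : nat -> C) (n : nat) :
  sum_n (fun k => c * s k)%C n = (c * sum_n s n)%C :> C.
Proof. exact (sum_n_mult_l (K := C_Ring) c s n). Qed.

Lemma add_mod_eqb_0 (N a : nat) :
  (0 < a < 2 * N)%nat -> a <> N -> Nat.eqb (a mod N) 0 = false.
Proof.
  intros Ha HaN. apply Nat.eqb_neq. intros E.
  pose proof (Nat.div_mod_eq a N) as Hd. rewrite E in Hd.
  destruct (a / N)%nat as [|[|k]]; nia.
Qed.

Lemma caratheodory_poly (c : nat -> C) (r B : R) (J n : nat) :
  0 <= r -> (1 <= n <= J)%nat ->
  (forall z, Cmod z = r -> Re (sum_n (fun j => c j * z ^ j)%C J) <= B) ->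
  Cmod (c n) * r ^ n <= 2 * (B - Re (c 0%nat)).
Proof.
  intros Hr Hn HB.
  destruct (unit_multiplier (c n)) as [u [Hu1 Hu]].
  (* Order [2 * J + 1] excludes aliasing: for [j <= J] the exponents [j] and [j + n] stay below [N],
     and [j + (N - n)] lies strictly between 0 and [2 * N]. *)
  set (N := S (2 * J)). set (w := root_unity N).
  set (P := fun k : nat => sum_n (fun j => c j * (r * w ^ k) ^ j)%C J : C).
  (* [N - n] replaces the exponent [-n], since [w ^ N = 1]. *)
  set (v := fun k : nat => (u * (w ^ k) ^ (N - n))%C).
  assert (Hw : Cmod w = 1) by apply Cmod_cis.
  assert (HwN : (w ^ N)%C = 1) by (apply root_unity_pow_N; unfold N; lia).
  assert (Hww : (w * Cconj w)%C = 1).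
  { rewrite <- Cmod2_conj, Hw. simpl. apply f_equal. ring. }
  assert (Hv1 : forall k, Cmod (v k) = 1).
  { intros k. unfold v. rewrite Cmod_mult, !Cmod_pow, Hw, !pow1, Hu1. ring. }
  (* Conjugation is inversion on the unit circle, and [w ^ N = 1] turns the exponent [-(N - n)] into
     [n]. *)
  assert (Hvc : forall k, Cconj (v k) = (Cconj u * (w ^ k) ^ n)%C).
  { intros k. unfold v. rewrite Cmult_conj, !Cpow_conj. f_equal.
    rewrite <- !Cpow_mult_r.
    assert (E : (w ^ (k * (N - n)) * w ^ (k * n))%C = 1).
    { rewrite <- Cpow_add_r.
      replace (k * (N - n) + k * n)%nat with (N * k)%nat by (unfold N; nia).
      rewrite Cpow_mult_r, HwN. apply Cpow_1_l. }
    transitivity (Cconj w ^ (k * (N - n)) * (w ^ (k * (N - n)) * w ^ (k * n)))%C;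
      [rewrite E; ring|].
    rewrite Cmult_assoc, <- Cpow_mult_l, (Cmult_comm (Cconj w)), Hww, Cpow_1_l. ring. }
  (* Only the real part of [T k] matters: it is the nonnegative product to be averaged. Each product
     with [P k] is given the shape of [root_unity_poly_sum], hence the factor with exponent 0. *)
  set (T := fun k => (B + B * v k - P k * (w ^ k) ^ 0
     - (u / 2) * (P k * (w ^ k) ^ (N - n)) - (Cconj u / 2) * (P k * (w ^ k) ^ n))%C).
  assert (HT : forall k, Re (T k) = (B - Re (P k)) * (1 + Re (v k))).
  { intros k.
    replace (T k) with (B + B * v k - P k - P k * ((v k + Cconj (v k)) / 2))%C.
    - rewrite <- re_alt. unfold Cminus.
      rewrite !re_plus, !re_opp, re_scal_l, re_scal_r, re_RtoC. ring.
    - rewrite Hvc. unfold T, v. simpl (_ ^ 0)%C. field. }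
  assert (Hpos : 0 <= Re (sum_n T (2 * J))).
  { rewrite Re_sum_n. apply sum_n_nonneg. intros k. rewrite HT.
    apply Rmult_le_pos.
    - assert (H := HB (r * w ^ k)%C). fold (P k) in H.
      rewrite Cmod_mult, Cmod_pow, Hw, pow1, Cmod_R, Rabs_pos_eq in H by assumption.
      specialize (H ltac:(ring)). lra.
    - pose proof (re_le_Cmod (v k)) as H. rewrite Hv1 in H.
      apply Rabs_le_between in H. lra. }
  assert (HS : sum_n T (2 * J) = (INR N * (B - c 0%nat - Cmod (c n) * r ^ n / 2))%C :> C).
  (* The bound variable fills the degree argument of the lemma; the exponent stays quantified and is
     fixed by each rewriting. *)
  { assert (Hsum := fun s => root_unity_poly_sum c r (2 * J) s). fold N w in Hsum.
    assert (H0 : sum_n (fun k => P k * (w ^ k) ^ 0)%C (2 * J) = (INR N * c 0%nat)%C :> C).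
    { unfold P. rewrite Hsum, (sum_n_single _ 0%nat).
      - rewrite Nat.Div0.mod_0_l. simpl. ring.
      - lia.
      - intros j Hj Hj0. rewrite add_mod_eqb_0 by (unfold N; lia). ring. }
    assert (H1 : sum_n (fun k => P k * (w ^ k) ^ (N - n))%C (2 * J)
                 = (INR N * (c n * r ^ n))%C :> C).
    { unfold P. rewrite Hsum, (sum_n_single _ n).
      - replace (n + (N - n))%nat with N by (unfold N; lia).
        rewrite Nat.Div0.mod_same. simpl Nat.eqb. cbv iota. ring.
      - lia.
      - intros j Hj Hjn. rewrite add_mod_eqb_0 by (unfold N; lia). ring. }
    assert (H2 : sum_n (fun k => P k * (w ^ k) ^ n)%C (2 * J) = 0 :> C).
    { unfold P. rewrite Hsum. apply sum_n_zero.
      intros j Hj. rewrite add_mod_eqb_0 by (unfold N; lia). ring. }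
    assert (H3 : sum_n v (2 * J) = 0 :> C).
    { unfold v. rewrite sum_n_C_mult_l.
      assert (E := root_unity_char_sum (2 * J) (N - n)). fold N w in E.
      rewrite E, add_mod_eqb_0 by (unfold N; lia). ring. }
    unfold T, Cminus. rewrite !sum_n_C_plus, sum_n_C_const, sum_n_C_mult_l, H3. fold N.
    rewrite (sum_n_ext (fun k => - (P k * (w ^ k) ^ 0))%C
              (fun k => - (1) * (P k * (w ^ k) ^ 0))%C) by (intros k; as_C; ring).
    rewrite (sum_n_ext (fun k => - (u / 2 * (P k * (w ^ k) ^ (N - n))))%C
              (fun k => - (u / 2) * (P k * (w ^ k) ^ (N - n)))%C) by (intros k; as_C; ring).
    rewrite (sum_n_ext (fun k => - (Cconj u / 2 * (P k * (w ^ k) ^ n)))%C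
              (fun k => - (Cconj u / 2) * (P k * (w ^ k) ^ n))%C) by (intros k; as_C; ring).
    rewrite !sum_n_C_mult_l, H0, H1, H2, <- Hu. field. }
  rewrite HS, re_scal_l in Hpos.
  assert (0 < INR N) by (apply lt_0_INR; unfold N; lia).
  assert (E : Re (B - c 0%nat - Cmod (c n) * r ^ n / 2)%C
              = B - Re (c 0%nat) - Cmod (c n) * r ^ n / 2).
  { unfold Cminus. rewrite !re_plus, !re_opp, <- RtoC_pow, <- RtoC_mult, <- RtoC_div, !re_RtoC by lra.
    ring. }
  rewrite E in Hpos. nra.
Qed.
(** * Coefficients of functions of class P *)

Lemma classP_coef_0 (a0 : R) (f : C -> C) (a : nat -> C) :
  classP_coef a0 f a -> Re (a 0%nat) = a0.
Proof. intros (_ & _ & ->). reflexivity. Qed.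

Lemma Taylor_disc_is_series (f : C -> C) (a : nat -> C) (z : C) :
  Taylor_disc f a -> Cmod z < 1 ->
  is_series (K := C_AbsRing) (V := C_NormedModule) (fun k => a k * z ^ k)%C (f z).
Proof.
  intros Hf Hz. eapply is_series_ext; [|exact (Hf z Hz)].
  intros k. simpl. rewrite pow_n_C. change (z ^ k * a k = a k * z ^ k)%C. ring.
Qed.

(** The terms of the series are bounded at a radius [R1] between [r] and 1, so on the circle of
    radius [r] the tails decay like powers of [r / R1], uniformly in [z]. The polynomial estimate
    then applies with [B = 1 + eps / 2]. *)
Lemma classP_coef_bound_pow (a0 : R) (f : C -> C) (a : nat -> C) (n : nat) (r : R) :
  classP_coef a0 f a -> (1 <= n)%nat -> 0 <= r < 1 ->
  Cmod (a n) * r ^ n <= 2 * (1 - a0).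
Proof.
  intros Hf Hn Hr. assert (Ha0 := classP_coef_0 _ _ _ Hf).
  destruct Hf as (HP & HT & _).
  set (R1 := (1 + r) / 2). assert (HR1 : r < R1 < 1) by (unfold R1; lra).
  assert (HCR1 : Cmod R1 = R1) by (rewrite Cmod_R; apply Rabs_pos_eq; lra).
  destruct (is_series_C_terms_bounded (fun k => a k * R1 ^ k)%C (f R1)) as [M HM].
  { apply Taylor_disc_is_series; [assumption|]. lra. }
  assert (HM0 : 0 <= M) by (eapply Rle_trans; [apply Cmod_ge_0|apply (HM 0%nat)]).
  set (t := r / R1).
  assert (Ht : 0 <= t < 1).
  { unfold t. split; [apply Rdiv_le_0_compat; lra|apply Rlt_div_l; lra]. }
  assert (Htail : forall N z, Cmod z = r ->
    Cmod (f z - sum_n (fun k => a k * z ^ k)%C N)%C <= M * t ^ S N / (1 - t)).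
  { intros N z Hz. apply is_series_C_geom_tail; try assumption.
    - intros k _. specialize (HM k). rewrite Cmod_mult, Cmod_pow in HM |- *.
      rewrite HCR1 in HM. rewrite Hz. replace r with (R1 * t) by (unfold t; field; lra).
      rewrite Rpow_mult_distr, <- Rmult_assoc.
      apply Rmult_le_compat_r; [apply pow_le; lra|assumption].
    - apply Taylor_disc_is_series; [assumption|lra]. }
  apply le_epsilon. intros eps He.
  assert (Hlim : is_lim_seq (fun N => M * t / (1 - t) * t ^ N) 0).
  { replace (Finite 0) with (Rbar_mult (M * t / (1 - t)) 0)
      by (simpl; f_equal; ring).
    apply is_lim_seq_scal_l, is_lim_seq_geom. rewrite Rabs_pos_eq; lra. }
  apply is_lim_seq_spec in Hlim.
  destruct (Hlim (mkposreal (eps / 2) ltac:(lra))) as [N0 HN0]. simpl in HN0.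
  (* Adding [n] ensures that the degree of the Taylor polynomial is at least [n]. *)
  set (N := (N0 + n)%nat). specialize (HN0 N ltac:(unfold N; lia)).
  apply Rabs_def2 in HN0.
  replace (2 * (1 - a0) + eps) with (2 * ((1 + eps / 2) - Re (a 0%nat)))
    by (rewrite Ha0; field).
  apply (caratheodory_poly a r (1 + eps / 2) N n); [lra|unfold N; lia|].
  intros z Hz. specialize (Htail N z Hz).
  assert (Hre : Re (f z) < 1) by (apply HP; lra).
  pose proof (re_le_Cmod (f z - sum_n (fun k => a k * z ^ k)%C N)%C) as Hd.
  unfold Cminus in Hd at 1. rewrite re_plus, re_opp in Hd.
  apply Rabs_le_between in Hd.
  assert (M * t ^ S N / (1 - t) = M * t / (1 - t) * t ^ N) by (simpl; field; lra).
  lra.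
Qed.

(** The radius tends to 1 along [1 - (/ 2) ^ k] in the preceding estimate. *)
Lemma classP_coef_bound (a0 : R) (f : C -> C) (a : nat -> C) (n : nat) :
  classP_coef a0 f a -> (1 <= n)%nat -> Cmod (a n) <= 2 * (1 - a0).
Proof.
  intros Hf Hn.
  assert (Hlim : is_lim_seq (fun k => Cmod (a n) * (1 - (/ 2) ^ k) ^ n)
                            (Cmod (a n) * (1 - 0) ^ n)).
  { apply (is_lim_seq_continuous (fun x => Cmod (a n) * (1 - x) ^ n)).
    - reg.
    - apply is_lim_seq_geom. rewrite Rabs_pos_eq; lra. }
  rewrite Rminus_0_r, pow1, Rmult_1_r in Hlim.
  refine (is_lim_seq_le _ (fun _ => 2 * (1 - a0)) (Finite _) (Finite _) _ Hlim
            (is_lim_seq_const _)).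
  intros k. apply (classP_coef_bound_pow a0 f); try assumption.
  assert (0 < (/ 2) ^ k) by (apply pow_lt; lra).
  assert ((/ 2) ^ k <= 1) by (rewrite <- (pow1 k); apply pow_incr; lra).
  lra.
Qed.

(** The series without its constant term is dominated by [2 * (1 - a0)] times the geometric series
    in [Cmod z]. *)
Lemma classP_dist_bound (a0 : R) (f : C -> C) (a : nat -> C) (z : C) :
  a0 < 1 -> classP_coef a0 f a -> Cmod z < 1 ->
  Cmod (f z - a 0%nat)%C <= 2 * (1 - a0) * Cmod z / (1 - Cmod z).
Proof.
  intros Ha0 Hf Hz. pose proof (Cmod_ge_0 z).
  assert (H1 := is_series_C_geom_tail (fun k => a k * z ^ k)%C (f z) 0
                  (2 * (1 - a0)) (Cmod z)).
  rewrite sum_O in H1. simpl Cpow in H1. rewrite Cmult_1_r, pow_1 in H1.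
  apply H1; [lra|lra| |].
  - intros k Hk. rewrite Cmod_mult, Cmod_pow.
    apply Rmult_le_compat_r; [apply pow_le; lra|].
    now apply (classP_coef_bound a0 f).
  - apply Taylor_disc_is_series; [apply Hf|assumption].
Qed.
(** * The extremal function *)

Definition extremal (a0 : R) (z : C) : C :=
  (a0 - (2 * (1 - a0))%R * (z / (1 - z)))%C.

Definition extremal_coef (a0 : R) (n : nat) : C :=
  match n with 0%nat => RtoC a0 | S _ => RtoC (- (2 * (1 - a0))) end.

Lemma one_minus_neq_0 (z : C) : Cmod z < 1 -> (1 - z <> 0)%C.
Proof.
  intros Hz E. assert (z = 1)%C as ->.
  { replace z with (1 - (1 - z))%C by ring. rewrite E. ring. }
  rewrite Cmod_1 in Hz. lra.
Qed.

(** The error of the linear approximation with slope [d] is exactly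
    [- c (y - z)^2 / ((1 - y) (1 - z)^2)]. *)
Lemma extremal_ex_derive (a0 : R) (z : C) :
  Cmod z < 1 -> ex_derive (K := C_AbsRing) (V := C_NormedModule) (extremal a0) z.
Proof.
  intros Hz. set (c := RtoC (2 * (1 - a0))).
  assert (Hz1 := one_minus_neq_0 z Hz).
  set (d := (- c / ((1 - z) * (1 - z)))%C).
  exists d. split.
  { apply (is_linear_scal_l (K := C_AbsRing) (V := C_NormedModule)). }
  intros x Hx.
  (* Differentiability is phrased at every limit [x] of the filter of neighbourhoods of [z]; such an
     [x] equals [z]. *)
  apply (is_filter_lim_locally_unique (K := C_AbsRing) (V := AbsRing_NormedModule C_AbsRing)) in Hx.
  subst x. intros eps.
  set (m := Cmod (1 - z)%C).
  assert (Hm : 0 < m) by (now apply Cmod_gt_0).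
  set (k := Cmod c). assert (Hk : 0 <= k) by apply Cmod_ge_0.
  pose proof (cond_pos eps) as He.
  (* The first bound keeps [Cmod (1 - y)] at least [m / 2]; the second makes the quadratic error at
     most [eps * Cmod (y - z)]. The summand 1 in [k + 1] avoids division by zero. *)
  assert (Hdl : 0 < Rmin (m / 2) (eps * m ^ 3 / (2 * (k + 1)))).
  { apply Rmin_glb_lt; [lra|].
    apply Rdiv_lt_0_compat; [|lra]. apply Rmult_lt_0_compat; [lra|]. now apply pow_lt. }
  exists (mkposreal _ Hdl). intros y Hy.
  change (Cmod (y - z)%C < Rmin (m / 2) (eps * m ^ 3 / (2 * (k + 1)))) in Hy.
  change (Cmod (extremal a0 y - extremal a0 z - (y - z) * d)%C <= eps * Cmod (y - z)%C).
  pose proof (Rmin_l (m / 2) (eps * m ^ 3 / (2 * (k + 1)))) as Hl.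
  pose proof (Rmin_r (m / 2) (eps * m ^ 3 / (2 * (k + 1)))) as Hr.
  assert (Hy2 : m / 2 <= Cmod (1 - y)%C).
  { pose proof (Cmod_triangle (1 - y)%C (y - z)%C) as Ht.
    replace ((1 - y) + (y - z))%C with (1 - z)%C in Ht by ring. fold m in Ht. lra. }
  assert (Hy1 : (1 - y <> 0)%C) by (apply Cmod_gt_0; lra).
  replace (extremal a0 y - extremal a0 z - (y - z) * d)%C
    with (- (c * ((y - z) * (y - z)) / ((1 - y) * ((1 - z) * (1 - z)))))%C
    by (unfold extremal, d; fold c; field; split; assumption).
  rewrite Cmod_opp, Cmod_div, !Cmod_mult by (repeat apply Cmult_neq_0; assumption).
  fold m k. set (e := Cmod (y - z)%C) in *.
  assert (He0 : 0 <= e) by apply Cmod_ge_0.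
  set (my := Cmod (1 - y)%C) in *.
  apply Rle_div_l. { apply Rmult_lt_0_compat; nra. }
  assert (He1 : e * (2 * (k + 1)) <= eps * m ^ 3) by (apply Rle_div_r; lra).
  assert (Hm3 : eps * e * (m / 2 * (m * m)) <= eps * e * (my * (m * m))).
  { apply Rmult_le_compat_l; [nra|]. apply Rmult_le_compat_r; [nra|lra]. }
  assert (k * (e * e) <= eps * e * (m / 2 * (m * m))); [|lra].
  simpl in He1. assert (e * (e * (2 * (k + 1))) <= e * (eps * (m * (m * (m * 1)))))
    by (now apply Rmult_le_compat_l).
  nra.
Qed.

(** The map [z / (1 - z)] sends the disc into the half-plane of real part above -1/2, because [|1 -
    z|^2 (1 + 2 Re (z / (1 - z))) = 1 - |z|^2]. *)
Lemma extremal_Re_lt_1 (a0 : R) (z : C) : a0 < 1 -> Cmod z < 1 -> Re (extremal a0 z) < 1.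
Proof.
  intros Ha Hz. assert (Hz1 := one_minus_neq_0 z Hz).
  unfold extremal. unfold Cminus at 1. rewrite re_plus, re_opp, re_scal_l, re_RtoC.
  assert (H : - 1 / 2 < Re (z / (1 - z))); [|nra].
  assert (H0 : (Re z) ^ 2 + (Im z) ^ 2 < 1).
  { rewrite <- Cmod2_alt. pose proof (Cmod_ge_0 z). nra. }
  apply Cmod_gt_0 in Hz1. assert (Hm : 0 < Cmod (1 - z)%C ^ 2) by now apply pow_lt.
  rewrite Cmod2_alt in Hm. destruct z as [x y]. simpl in H0, Hm.
  unfold Cdiv, Cinv, Cmult. simpl.
  match goal with |- _ < ?l => replace l with
    ((x - (x * x + y * y)) / ((1 - x) * (1 - x) + y * y)) by (field; nra) end.
  assert (HD : 0 < (1 - x) * (1 - x) + y * y) by lra.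
  apply (Rmult_lt_reg_r _ _ _ HD). unfold Rdiv at 2.
  rewrite Rmult_assoc, Rinv_l by lra. lra.
Qed.

(** The partial sums have a closed form, with remainder a constant times [z ^ S n]. *)
Lemma extremal_Taylor (a0 : R) : Taylor_disc (extremal a0) (extremal_coef a0).
Proof.
  intros z Hz. assert (Hz1 := one_minus_neq_0 z Hz).
  set (c := RtoC (2 * (1 - a0))).
  apply is_series_ext with (a := (fun k => z ^ k * extremal_coef a0 k)%C).
  { intros k. rewrite <- pow_n_C. reflexivity. }
  assert (Hsum : forall n, sum_n (fun k => z ^ k * extremal_coef a0 k)%C n
            = (extremal a0 z + c / (1 - z) * z ^ S n)%C :> C).
  { induction n as [|n IH].
    - rewrite sum_O. unfold extremal; fold c. simpl. as_C. field. assumption.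
    - rewrite sum_Sn, IH. change (plus ?x ?y) with (x + y)%C. simpl extremal_coef.
      rewrite RtoC_opp. fold c. rewrite (Cpow_S z (S n)). as_C. field. assumption. }
  apply is_series_C_eps. intros eps.
  pose proof (Cmod_ge_0 z) as Hz0.
  set (K := Cmod (c / (1 - z))%C).
  assert (Hlim : is_lim_seq (fun n => K * Cmod z * Cmod z ^ n) 0).
  { replace (Finite 0) with (Rbar_mult (K * Cmod z) 0) by (simpl; f_equal; ring).
    apply is_lim_seq_scal_l, is_lim_seq_geom. rewrite Rabs_pos_eq; lra. }
  apply is_lim_seq_spec in Hlim. destruct (Hlim eps) as [N HN].
  exists N. intros n Hn. specialize (HN n Hn). rewrite Hsum.
  replace (extremal a0 z + c / (1 - z) * z ^ S n - extremal a0 z)%C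
    with (c / (1 - z) * z ^ S n)%C by ring.
  rewrite Cmod_mult, Cmod_pow. fold K. apply Rabs_def2 in HN. simpl. lra.
Qed.

Lemma extremal_classP_coef (a0 : R) :
  a0 < 1 -> classP_coef a0 (extremal a0) (extremal_coef a0).
Proof.
  intros Ha. split; [|split; [apply extremal_Taylor|reflexivity]].
  intros z Hz. split; [now apply extremal_ex_derive|now apply extremal_Re_lt_1].
Qed.
(** * Real powers *)

Lemma rpow_pos (x y : R) : 0 < x -> rpow x y = Rpower x y.
Proof. intros Hx. unfold rpow. now destruct (Rlt_dec 0 x). Qed.

Lemma rpow_0_l (y : R) : rpow 0 y = 0.
Proof. unfold rpow. destruct (Rlt_dec 0 0); [lra|reflexivity]. Qed.

Lemma rpow_nonneg (x y : R) : 0 <= rpow x y.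
Proof.
  unfold rpow. destruct (Rlt_dec 0 x); [left; apply exp_pos|lra].
Qed.

Lemma rpow_le_compat_l (x y q : R) : 0 <= q -> 0 <= x <= y -> rpow x q <= rpow y q.
Proof.
  intros Hq [[Hx| <-] Hxy]; [|rewrite rpow_0_l; apply rpow_nonneg].
  rewrite !rpow_pos by lra. apply Rle_Rpower_l; lra.
Qed.

Lemma rpow_le_1 (x q : R) : 0 <= q -> 0 <= x <= 1 -> rpow x q <= 1.
Proof.
  intros Hq Hx. replace 1 with (rpow 1 q); [now apply rpow_le_compat_l|].
  rewrite rpow_pos by lra. unfold Rpower. rewrite ln_1, Rmult_0_r. apply exp_0.
Qed.

Lemma rpow_mult_distr (x y q : R) :
  0 <= x -> 0 <= y -> rpow (x * y) q = rpow x q * rpow y q.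
Proof.
  intros [Hx| <-] [Hy| <-]; rewrite ?Rmult_0_l, ?Rmult_0_r, ?rpow_0_l; try ring.
  rewrite !rpow_pos by (try apply Rmult_lt_0_compat; assumption).
  now rewrite Rpower_mult_distr.
Qed.

Lemma rpow_div (x y q : R) : 0 <= x -> 0 < y -> rpow (x / y) q = rpow x q / rpow y q.
Proof.
  intros Hx Hy. assert (Hq : 0 < rpow y q) by (rewrite rpow_pos by assumption; apply exp_pos).
  apply (Rmult_eq_reg_r (rpow y q)); [|lra].
  rewrite <- rpow_mult_distr; [|apply Rdiv_le_0_compat; lra|lra].
  replace (x / y * y) with x by (field; lra). field. lra.
Qed.

Lemma rpow_pow_l (x q : R) (m : nat) :
  (1 <= m)%nat -> 0 <= x -> rpow (x ^ m) q = rpow x (INR m * q).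
Proof.
  intros Hm [Hx| <-].
  - rewrite !rpow_pos by (try apply pow_lt; assumption).
    rewrite <- Rpower_pow by assumption. apply Rpower_mult.
  (* At 0 the condition [1 <= m] matters: [0 ^ 0 = 1] would make the left side 1, against 0 on the
     right. *)
  - rewrite pow_i by lia. now rewrite !rpow_0_l.
Qed.

Lemma rpow_pred (x q : R) : 0 < x -> rpow x q = x * rpow x (q - 1).
Proof.
  intros Hx. rewrite !rpow_pos by assumption.
  rewrite <- (Rpower_1 x Hx) at 2. rewrite <- Rpower_plus. f_equal. ring.
Qed.

Lemma rpow_1_r (x : R) : 0 <= x -> rpow x 1 = x.
Proof.
  intros [Hx| <-]; [|apply rpow_0_l].
  rewrite rpow_pos by assumption. now apply Rpower_1.
Qed.

Lemma rpow_2_r (x : R) : 0 <= x -> rpow x 2 = x * x.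
Proof.
  intros [Hx| <-]; [|rewrite rpow_0_l; ring].
  rewrite rpow_pred by assumption. replace (2 - 1) with 1 by ring.
  rewrite rpow_1_r; lra.
Qed.

(** With [s = x^p] and [L = ln x], the inequality [exp u >= 1 + u] gives [x >= s (1 + (1 - p) L)]
    and [1 >= s (1 - p L)]; with weights [p] and [1 - p] the terms in [L] cancel. *)
Lemma rpow_bernoulli (x p : R) : 0 < p <= 1 -> 0 <= x -> rpow x p <= 1 - p * (1 - x).
Proof.
  intros Hp [Hx| <-]; [|rewrite rpow_0_l; lra].
  rewrite rpow_pos by assumption. unfold Rpower. set (L := ln x).
  assert (E1 : x = exp (p * L) * exp ((1 - p) * L)).
  { rewrite <- exp_plus. replace (p * L + (1 - p) * L) with L by ring.
    unfold L. now rewrite exp_ln. }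
  assert (E2 : 1 = exp (p * L) * exp (- (p * L))).
  { rewrite <- exp_plus, Rplus_opp_r. symmetry. apply exp_0. }
  pose proof (exp_pos (p * L)) as Hs.
  assert (H1 := exp_ineq1_le ((1 - p) * L)).
  assert (H2 := exp_ineq1_le (- (p * L))).
  set (s := exp (p * L)) in *.
  apply (Rmult_le_compat_l s) in H1; [|lra]. rewrite <- E1 in H1.
  apply (Rmult_le_compat_l s) in H2; [|lra]. rewrite <- E2 in H2.
  apply (Rmult_le_compat_l p) in H1; [|lra].
  apply (Rmult_le_compat_l (1 - p)) in H2; [|lra].
  lra.
Qed.

Lemma rpow_mult_pow_ratio (c q r : R) (m : nat) :
  0 <= c -> (1 <= m)%nat -> 0 <= r < 1 ->
  rpow (c * (r ^ m / (1 - r ^ m))) q = rpow c q * Kmq q m r.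
Proof.
  intros Hc Hm Hr.
  assert (0 <= r ^ m < 1) by (split; [apply pow_le; lra|apply pow_lt_1_compat; [lra|lia]]).
  rewrite rpow_mult_distr, rpow_div by (try apply Rdiv_le_0_compat; lra).
  unfold Kmq. rewrite rpow_pow_l by (lia || lra). reflexivity.
Qed.

Lemma Kmq_nonneg (q r : R) (m : nat) : (1 <= m)%nat -> 0 <= r < 1 -> 0 <= Kmq q m r.
Proof.
  intros Hm Hr.
  assert (0 <= r ^ m < 1) by (split; [apply pow_le; lra|apply pow_lt_1_compat; [lra|lia]]).
  apply Rdiv_le_0_compat; [apply rpow_nonneg|].
  rewrite rpow_pos by lra. apply exp_pos.
Qed.

(** * The functional E_f *)

Lemma classF_ex_series (zeta : nat -> R -> R) (r : R) :
  classF zeta -> 0 <= r < 1 -> ex_series (fun n => zeta n r).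
Proof.
  intros (_ & _ & H) Hr. destruct (H r Hr) as [delta Hd].
  exists (real (Lim_seq (sum_n (fun n => zeta n r)))).
  apply (is_lim_seq_spec (sum_n (fun n => zeta n r)) (Finite _)).
  intros eps. destruct (Hd eps) as [N HN].
  exists N. intros n Hn. apply (HN n Hn r).
  split; [assumption|]. rewrite Rminus_diag, Rabs_R0. apply cond_pos.
Qed.

(** Termwise comparison with [zeta]. A divergent series of nonnegative terms would have [Series]
    equal to 0, so convergence is recorded with the bound. *)
Lemma coef_series_le (zeta : nat -> R -> R) (a0 : R) (f : C -> C) (a : nat -> C) (r : R) :
  classF zeta -> classP_coef a0 f a -> 0 <= r < 1 ->
  ex_series (fun n => Cmod (a (S n)) * zeta (S n) r) /\
  Series (fun n => Cmod (a (S n)) * zeta (S n) r) <= 2 * (1 - a0) * Phi1 zeta r.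
Proof.
  intros Hz Hf Hr.
  assert (Hle : forall n, 0 <= Cmod (a (S n)) * zeta (S n) r
                          <= 2 * (1 - a0) * zeta (S n) r).
  { intros n. assert (0 <= zeta (S n) r) by now apply Hz. split.
    - apply Rmult_le_pos; [apply Cmod_ge_0|assumption].
    - apply Rmult_le_compat_r; [assumption|].
      apply (classP_coef_bound a0 f); [assumption|lia]. }
  assert (Hex : ex_series (fun n => 2 * (1 - a0) * zeta (S n) r)).
  { apply (ex_series_scal_l (K := R_AbsRing) (V := R_NormedModule)).
    apply (ex_series_incr_1 (fun n => zeta n r)). now apply classF_ex_series. }
  split.
  - apply (ex_series_le (K := R_AbsRing) (V := R_CompleteNormedModule)
             _ (fun n => 2 * (1 - a0) * zeta (S n) r)); [|assumption].
    intros n. change (Rabs (Cmod (a (S n)) * zeta (S n) r) <= 2 * (1 - a0) * zeta (S n) r).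
    rewrite Rabs_pos_eq; apply Hle.
  - unfold Phi1. rewrite <- Series_scal_l. now apply Series_le.
Qed.

(** Common source of both upper bounds: one factor [1 - a0] is split off the [q]-th power, leaving
    the exponent [q - 1]. *)
Lemma Ef_le (q : R) (m : nat) (zeta : nat -> R -> R) (p a0 : R)
    (f : C -> C) (a : nat -> C) (z : C) :
  1 <= q -> (1 <= m)%nat -> classF zeta -> a0 < 1 -> classP_coef a0 f a ->
  Cmod z < 1 ->
  Ef q m zeta p f a z <=
  rpow a0 p * zeta 0%nat (Cmod z) + (1 - a0) * (2 * Phi1 zeta (Cmod z)
    + rpow 2 q * rpow (1 - a0) (q - 1) * Kmq q m (Cmod z)).
Proof.
  intros Hq Hm Hz Ha0 Hf Hz1. pose proof (Cmod_ge_0 z) as Hz0.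
  unfold Ef. rewrite (classP_coef_0 _ _ _ Hf).
  destruct (coef_series_le zeta a0 f a (Cmod z) Hz Hf ltac:(lra)) as [_ HS].
  assert (0 <= Cmod z ^ m < 1)
    by (split; [apply pow_le; lra|apply pow_lt_1_compat; [lra|lia]]).
  assert (Hd : Cmod (f (z ^ m) - a 0%nat)%C
               <= 2 * (1 - a0) * (Cmod z ^ m / (1 - Cmod z ^ m))).
  { pose proof (classP_dist_bound a0 f a (z ^ m)%C Ha0 Hf) as H'.
    rewrite Cmod_pow in H'. unfold Rdiv in *. rewrite <- Rmult_assoc. apply H'. lra. }
  assert (HK : rpow (Cmod (f (z ^ m) - a 0%nat)%C) q
               <= rpow 2 q * rpow (1 - a0) q * Kmq q m (Cmod z)).
  { rewrite <- rpow_mult_distr, <- rpow_mult_pow_ratio by (lia || lra).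
    apply rpow_le_compat_l; [lra|]. split; [apply Cmod_ge_0|assumption]. }
  rewrite (rpow_pred (1 - a0) q) in HK by lra.
  lra.
Qed.

(** At a real point [r >= 0] the bound of [Ef_le] is attained: every coefficient beyond the constant
    one has modulus [2 * (1 - a0)], and they share one sign, so nothing cancels at [r ^ m]. *)
Lemma Ef_extremal (q : R) (m : nat) (zeta : nat -> R -> R) (p a0 r : R) :
  (1 <= m)%nat -> a0 < 1 -> 0 <= r < 1 ->
  Ef q m zeta p (extremal a0) (extremal_coef a0) r =
  rpow a0 p * zeta 0%nat r + (1 - a0) * (2 * Phi1 zeta r
    + rpow 2 q * rpow (1 - a0) (q - 1) * Kmq q m r).
Proof.
  intros Hm Ha0 Hr. unfold Ef.
  assert (Hrm : 0 <= r ^ m < 1)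
    by (split; [apply pow_le; lra|apply pow_lt_1_compat; [lra|lia]]).
  rewrite Cmod_R, (Rabs_pos_eq r) by lra.
  rewrite (Series_ext _ (fun n => 2 * (1 - a0) * zeta (S n) r)).
  2:{ intros n. simpl extremal_coef. rewrite Cmod_R, Rabs_Ropp, Rabs_pos_eq by lra.
      reflexivity. }
  rewrite Series_scal_l. fold (Phi1 zeta r).
  replace (Cmod (extremal a0 (r ^ m) - extremal_coef a0 0)%C)
    with (2 * (1 - a0) * (r ^ m / (1 - r ^ m))).
  2:{ simpl extremal_coef. unfold extremal.
      rewrite <- RtoC_pow, <- RtoC_minus, <- RtoC_div, <- RtoC_mult, <- !RtoC_minus by lra.
      rewrite Cmod_R. set (x := r ^ m / (1 - r ^ m)).
      assert (0 <= x) by (apply Rdiv_le_0_compat; lra).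
      rewrite <- Rabs_Ropp, Rabs_pos_eq; nra. }
  rewrite rpow_mult_pow_ratio, rpow_mult_distr, (rpow_pred (1 - a0) q) by (lia || lra).
  simpl. ring.
Qed.

(** * Sharpness of the radii and the two ranges of the exponent *)

Lemma sharp_radius_intro (Fam : (C -> C) -> (nat -> C) -> Prop)
    (E : (C -> C) -> (nat -> C) -> C -> R) (g h : R -> R) (rho : R) :
  (forall r, rho < r < 1 -> g r < h r ->
     exists f a z, Fam f a /\ Cmod z = r /\ g r < E f a z) ->
  sharp_radius Fam E g h rho.
Proof.
  intros H. split; [exact H|]. intros Hnear s Hs Hup.
  (* With [eps = s - rho] the violating radius lies below [s], where the inequality is assumed. *)
  destruct (Hnear (s - rho) ltac:(lra)) as (r & Hr & Hr1 & Hgh).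
  destruct (H r ltac:(lra) Hgh) as (f & a & z & Hf & Hz & Hlt).
  specialize (Hup f a z Hf ltac:(lra)). rewrite Hz in Hup. lra.
Qed.

(* [a0 = exp (- t)] with [t] small: then [1 - a0^p <= p t] and [1 - a0 >= t / (1 + t)]. *)
Lemma rpow_near_1 (p x y : R) :
  0 < p <= 1 -> 0 <= x < y ->
  (* The choice of [t] gives [t * (x + 1) = (y - x) / 2], hence [(1 + t) * x < y]. *)
  exists a0, 0 <= a0 < 1 /\ (1 - rpow a0 p) * x < p * (1 - a0) * y.
Proof.
  intros Hp Hxy. set (t := (y - x) / (2 * (x + 1))).
  assert (Ht : 0 < t) by (apply Rdiv_lt_0_compat; lra).
  assert (Htx : t * (2 * (x + 1)) = y - x) by (unfold t; field; lra).
  pose proof (exp_pos (- t)) as He.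
  assert (Hinv : exp (- t) * exp t = 1)
    by (rewrite <- exp_plus, Rplus_opp_l; apply exp_0).
  pose proof (exp_ineq1_le t) as H1.
  assert (Hb : exp (- t) * (1 + t) <= 1) by nra.
  exists (exp (- t)). split; [nra|].
  rewrite rpow_pos by assumption. unfold Rpower. rewrite ln_exp.
  pose proof (exp_ineq1_le (p * - t)) as H2.
  assert (L1 : (1 - exp (p * - t)) * x <= p * t * x)
    by (apply Rmult_le_compat_r; lra).
  assert (L2 : p * t * x < p * (1 - exp (- t)) * y); [|lra].
  rewrite !Rmult_assoc. apply Rmult_lt_compat_l; [lra|].
  assert (L3 : t <= (1 - exp (- t)) * (1 + t)) by lra.
  assert (L4 : (1 + t) * x < y) by lra.
  assert (L5 : 0 < 1 - exp (- t)) by nra.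
  apply Rle_lt_trans with ((1 - exp (- t)) * (1 + t) * x).
  - apply Rmult_le_compat_r; lra.
  - rewrite Rmult_assoc. now apply Rmult_lt_compat_l.
Qed.

Theorem theorem2 (q : R) (m : nat) (zeta : nat -> R -> R)
    (hq : 1 <= q) (hm : (1 <= m)%nat) (hzeta : classF zeta) :
  (* the series in E_f converges on the disc *)
  (forall (a0 : R) (f : C -> C) (a : nat -> C) (z : C),
      0 <= a0 < 1 -> classP_coef a0 f a -> Cmod z < 1 ->
      ex_series (fun n => Cmod (a (S n)) * zeta (S n) (Cmod z)))
  /\
  (* (i) *)
  (forall p rho : R,
      let B := fun r =>
        2 / p * (Phi1 zeta r + rpow 2 (q - 1) * Kmq q m r) in
      let Fam := fun f a =>
        exists a0, 0 <= a0 < 1 /\ classP_coef a0 f a in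
      0 < p <= 1 ->
      min_pos_root (zeta 0%nat) B rho ->
      (forall r, 0 <= r <= rho -> zeta 0%nat r >= B r) ->
      holds_upto Fam (Ef q m zeta p) (zeta 0%nat) rho /\
      (p = 1 \/ q = 1 ->
       sharp_radius Fam (Ef q m zeta p) (zeta 0%nat) B rho))
  /\
  (* (ii) *)
  (forall a0 rho : R,
      let psi := fun r =>
        (2 * Phi1 zeta r + rpow 2 q * rpow (1 - a0) (q - 1) * Kmq q m r)
        / (1 + a0) in
      0 <= a0 < 1 ->
      min_pos_root (zeta 0%nat) psi rho ->
      (forall r, 0 <= r <= rho -> zeta 0%nat r >= psi r) ->
      holds_upto (classP_coef a0) (Ef q m zeta 2) (zeta 0%nat) rho /\
      sharp_radius (classP_coef a0) (Ef q m zeta 2) (zeta 0%nat) psi rho).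
Proof.
  split; [|split].
  - intros a0 f a z Ha0 Hf Hz. pose proof (Cmod_ge_0 z).
    apply (coef_series_le zeta a0 f a (Cmod z) hzeta Hf). lra.
  - intros p rho B Fam Hp Hrho HB. destruct Hrho as (Hrho & _).
    (* Since [2^q = 2 * 2^(q-1)], the bracket of [Ef_le] without its power of [1 - a0] is
       [p * B r]. *)
    assert (EB : forall r, 2 * Phi1 zeta r + rpow 2 q * Kmq q m r = p * B r).
    { intros r. unfold B. rewrite (rpow_pred 2 q) by lra. field. lra. }
    assert (Hz0 : forall r, 0 <= r < 1 -> 0 <= zeta 0%nat r) by apply hzeta.
    split.
    + intros f a z (a0 & Ha0 & Hf) Hz. pose proof (Cmod_ge_0 z).
      eapply Rle_trans; [apply (Ef_le q m zeta p a0); (assumption || lra)|].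
      set (r := Cmod z) in *.
      assert (HBr := HB r ltac:(lra)). assert (Hzr := Hz0 r ltac:(lra)).
      (* Two estimates suffice: [1 - a0^p >= p (1 - a0)] and [(1 - a0)^(q-1) <= 1]. *)
      pose proof (rpow_bernoulli a0 p Hp (proj1 Ha0)) as Hber.
      pose proof (rpow_le_1 (1 - a0) (q - 1) ltac:(lra) ltac:(lra)) as H1.
      pose proof (Kmq_nonneg q r m hm ltac:(lra)) as HK.
      pose proof (rpow_nonneg 2 q) as H2.
      assert (H3 : 2 * Phi1 zeta r + rpow 2 q * rpow (1 - a0) (q - 1) * Kmq q m r
                   <= p * B r).
      { rewrite <- EB. apply Rplus_le_compat_l, Rmult_le_compat_r; [assumption|nra]. }
      assert (H4 : p * B r <= p * zeta 0%nat r) by (apply Rmult_le_compat_l; lra).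
      assert (H5 : (1 - a0) * (2 * Phi1 zeta r
                    + rpow 2 q * rpow (1 - a0) (q - 1) * Kmq q m r)
                   <= (1 - a0) * (p * zeta 0%nat r))
        by (apply Rmult_le_compat_l; lra).
      assert (H6 : rpow a0 p * zeta 0%nat r <= (1 - p * (1 - a0)) * zeta 0%nat r)
        by (apply Rmult_le_compat_r; lra).
      lra.
    + intros Hpq. apply sharp_radius_intro. intros r Hr Hlt.
      assert (Hzr := Hz0 r ltac:(lra)).
      (* As the extremal function attains the bound, only a suitable [a0] remains to be found. *)
      cut (exists a0, 0 <= a0 < 1 /\ zeta 0%nat r <
             rpow a0 p * zeta 0%nat r + (1 - a0) * (2 * Phi1 zeta r
               + rpow 2 q * rpow (1 - a0) (q - 1) * Kmq q m r)).
      { intros (a0 & Ha0 & HE).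
        exists (extremal a0), (extremal_coef a0), (RtoC r). split; [|split].
        - exists a0. split; [assumption|]. apply extremal_classP_coef. lra.
        - rewrite Cmod_R. apply Rabs_pos_eq. lra.
        - rewrite Ef_extremal by (lia || lra). exact HE. }
      destruct Hpq as [-> | ->].
      (* At [a0 = 0] the term in [zeta 0] vanishes and [(1 - a0)^(q-1)] is 1, so the value is
         [B r]. *)
      * exists 0. split; [lra|]. rewrite rpow_0_l, Rminus_0_r.
        replace (rpow 1 (q - 1)) with 1.
        -- rewrite Rmult_1_r, EB. lra.
        -- rewrite rpow_pos by lra. unfold Rpower. now rewrite ln_1, Rmult_0_r, exp_0.
      (* For [q = 1] the power of [1 - a0] disappears, and the claim becomes
         [(1 - a0^p) zeta_0 < p (1 - a0) B]. *)
      * destruct (rpow_near_1 p (zeta 0%nat r) (B r) Hp ltac:(lra)) as (a0 & Ha0 & Hlt').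
        exists a0. split; [assumption|].
        replace (rpow (1 - a0) (1 - 1)) with 1.
        -- rewrite Rmult_1_r, EB. lra.
        -- rewrite Rminus_diag, rpow_pos by lra. symmetry. apply Rpower_O. lra.
  - intros a0 rho psi Ha0 (Hrho & _) Hpsi.
    assert (Epsi : forall r, 2 * Phi1 zeta r
              + rpow 2 q * rpow (1 - a0) (q - 1) * Kmq q m r = (1 + a0) * psi r).
    { intros r. unfold psi. field. lra. }
    split.
    + intros f a z Hf Hz. pose proof (Cmod_ge_0 z).
      eapply Rle_trans; [apply (Ef_le q m zeta 2 a0); (assumption || lra)|].
      rewrite Epsi, rpow_2_r by lra. assert (Hr := Hpsi (Cmod z) ltac:(lra)).
      (* The bound is [a0^2 zeta_0 + (1 - a0^2) psi], a convex combination of [zeta_0] and [psi]. *)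
      assert (Hp : 0 <= (1 - a0) * (1 + a0)) by nra.
      apply Rge_le, (Rmult_le_compat_l _ _ _ Hp) in Hr. lra.
    + apply sharp_radius_intro. intros r Hr Hlt.
      (* Here [a0] is prescribed; the same convex combination exceeds [zeta_0] as soon as [psi]
         does, because [1 - a0^2 > 0]. *)
      exists (extremal a0), (extremal_coef a0), (RtoC r). split; [|split].
      * apply extremal_classP_coef. lra.
      * rewrite Cmod_R. apply Rabs_pos_eq. lra.
      * rewrite Ef_extremal, Epsi, rpow_2_r by (lia || lra).
        assert (Hp : 0 < (1 - a0) * (1 + a0)) by nra.
        apply (Rmult_lt_compat_l _ _ _ Hp) in Hlt. lra.
Qed.
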